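(* Let $m$ be a positive integer, and let $G$ and $w(\cdot)$ be the group and the word associated with $m$ as defined in the context. The conjugacy class $[w(\cdot)]$ in $G$ is an invariant of free knots; that is, if two chord diagrams $c_1,c_2$ represent the same free knot (they are connected by a finite sequence of first, second and third Reidemeister moves and changes of the initial point), then $w(c_1)$ and $w(c_2)$ are conjugate in $G$.
   Context: **Chord diagrams.** A chord diagram (with a base point) is an unordered partition $a=\{(p_1,q_1),\dots,(p_n,q_n)\}$ of $\{1,2,\dots,2n\}$ into $n$ unordered two-element sets ($n\ge 0$; for $n=0$ the diagram is empty). Each pair is called a chord, and its two elements are the ends of the chord. Two chords $(p_i,q_i),(p_j,q_j)$ are linked if $(p_i-p_j)(p_i-q_j)(q_i-p_j)(q_i-q_j)<0$, and unlinked otherwise. For a set of chords $b$ and a chord $p$, $g(p,b)$ denotes the number of chords in $b$ linked with $p$ (a chord is not linked with itself). **Classes of chords.** Fix a positive integer $m$. For a chord diagram $a$, put $a_0=\{p\in a : g(p,a)\text{ is odd}\}$ and, inductively for $1\le k\le m-1$, $$a_k=\Big\{p\in a\setminus\bigcup_{i<k}a_i \;:\; g\Big(p,a\setminus\bigcup_{i<k}a_i\Big)\text{ is odd}\Big\}.$$ Put $a_m=a\setminus\bigcup_{j=0}^{m-1}a_j$. For $0\le k\le m-1$ split $a_k=a'_k\sqcup a''_k$, where $a'_k=\{p\in a_k : g(p,a_k)\text{ is odd}\}$ and $a''_k=a_k\setminus a'_k$. Thus every chord belongs to exactly one of the subsets $a'_0,a''_0,\dots,a'_{m-1},a''_{m-1},a_m$.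 **The group $G$.** Let $D=\{a'_0,a''_0,a'_1,a''_1,\dots,a'_{m-1},a''_{m-1},a_m\}$ be regarded as a set of $2m+1$ formal letters. $G$ (depending on $m$) is the group generated by $D$ with the relations - $a'_ia'_i=e$ and $a''_ia''_i=e$ for $0\le i\le m-1$, and $a_ma_m=e$; - $a''_ia'_j=a'_ja'_i$ and $a''_ia''_j=a''_ja'_i$ for $0\le i<j\le m-1$; - $a'_ia_m=a_ma''_i$ for $0\le i<m$. **The word $w(c)$.** For a chord diagram $c$ with $n$ chords, $w(c)$ is the word of length $2n$ in the alphabet $D$ whose $k$-th letter ($1\le k\le 2n$) is the letter naming the class (among $a'_0,a''_0,\dots,a'_{m-1},a''_{m-1},a_m$, computed for $c$) that contains the chord having $k$ as an end. It is regarded as an element of $G$ (the empty word is $e$). **Reidemeister moves.** - First move: addition to, or removal from, a chord diagram of a chord $(p,q)$ with $|p-q|=1$. - Second move: addition or removal of a pair of adjacent chords. Two chords $(p_i,q_i),(p_j,q_j)$ are adjacent if $|\min(p_i,q_i)-\min(p_j,q_j)|=|\max(p_i,q_i)-\max(p_j,q_j)|=1$. - In the first and second moves the ends of the remaining chords are renumbered accordingly, in the order-preserving way, so that the ends of the resulting diagram are again $1,\dots,2n'$. - Third move: three chords of a diagram form a completely adjoint triple $T$ if their six ends can be partitioned into three pairs such that each pair consists of ends of two different chords and the two numbers in each pair differ by one. The set of the six ends is then $S=\{r,r+1,s,s+1,t,t+1\}$, where $\{r,r+1\},\{s,s+1\},\{t,t+1\}$ are these pairs. Let $f:S\to S$ be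 the involution $r\leftrightarrow r+1$, $s\leftrightarrow s+1$, $t\leftrightarrow t+1$. Let $T'$ be the triple of chords with the same set $S$ of ends, in which $u,v\in S$ form a chord if and only if $f(u),f(v)$ form a chord of $T$. The third move replaces $T$ by $T'$ and leaves all other chords fixed. **Free knots.** A long free knot is an equivalence class of chord diagrams with a base point under the equivalence relation generated by these three moves. The change of the initial point is the move that applies the cyclic permutation $1\to2\to\dots\to 2n\to1$ to the ends of all chords of a diagram with $n$ chords. A free knot is an equivalence class of chord diagrams under the equivalence relation generated by the three Reidemeister moves and the change of the initial point. *)

(* Defs.v *)
From HB Require Import structures.
From Stdlib Require Import Relation_Operators.
From mathcomp Require Import all_boot all_order all_algebra all_fingroup.
From mathcomp Require Import boolp.

Set Implicit Arguments.
Unset Strict Implicit.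
Unset Printing Implicit Defensive.

Import Order.TTheory GRing.Theory Num.Theory.

(** * Groups given by generators and relations *)

Section Presentation.
Variables (X : choiceType) (rels : seq (X * bool) -> seq (X * bool) -> Prop).

(* A signed word: (x, true) stands for the generator x, (x, false) for x^-1. *)
Local Notation sword := (seq (X * bool)).
Local Notation repr := generic_quotient.repr.

(* The least congruence on signed words making x and x^-1 mutually inverse and
   containing [rels]. *)
Inductive pres_eq : sword -> sword -> Prop :=
| pres_rel u v of rels u v : pres_eq u v
| pres_cancel x b : pres_eq [:: (x, b); (x, ~~ b)] [::]
| pres_cat u u' v v' of pres_eq u u' & pres_eq v v' :
    pres_eq (u ++ v) (u' ++ v')
| pres_refl u : pres_eq u u
| pres_sym u v of pres_eq u v : pres_eq v u
| pres_trans u v w of pres_eq u v & pres_eq v w : pres_eq u w.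

Definition pres_eqb : rel sword := fun u v => `[< pres_eq u v >].

Lemma pres_eqb_refl : reflexive pres_eqb.
Proof. by move=> u; apply/asboolP; apply: pres_refl. Qed.

Lemma pres_eqb_sym : symmetric pres_eqb.
Proof. by move=> u v; apply/asboolP/asboolP; apply: pres_sym. Qed.

Lemma pres_eqb_trans : transitive pres_eqb.
Proof.
move=> v u w /asboolP uv /asboolP vw; apply/asboolP.
exact: pres_trans uv vw.
Qed.

Canonical pres_equiv :=
  EquivRel pres_eqb pres_eqb_refl pres_eqb_sym pres_eqb_trans.

Definition presented : Type := {eq_quot pres_equiv}%qT.
HB.instance Definition _ := EqQuotient.on presented.
HB.instance Definition _ := Choice.on presented.

Definition pres_pi (u : sword) : presented := (\pi_presented u)%qT.

Lemma pres_piP u v : pres_pi u = pres_pi v <-> pres_eq u v.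
Proof.
split; first by move/eqmodP/asboolP.
by move=> uv; apply/eqmodP/asboolP.
Qed.

Lemma pres_piK a : pres_pi (repr a) = a.
Proof. exact: reprK. Qed.

Definition sword_inv (u : sword) : sword := rev [seq (x.1, ~~ x.2) | x <- u].

Definition pres_one : presented := pres_pi [::].
Definition pres_mul (a b : presented) : presented := pres_pi (repr a ++ repr b).
Definition pres_inv (a : presented) : presented := pres_pi (sword_inv (repr a)).

Lemma pres_mulE u v : pres_mul (pres_pi u) (pres_pi v) = pres_pi (u ++ v).
Proof. by apply/pres_piP/pres_cat; apply/pres_piP/pres_piK. Qed.

Lemma sword_invK : involutive sword_inv.
Proof.
move=> u; rewrite /sword_inv map_rev revK -map_comp -[RHS]map_id.
by apply: eq_map => -[x b] /=; rewrite negbK.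
Qed.

Lemma sword_mulV u : pres_eq (u ++ sword_inv u) [::].
Proof.
elim: u => [|[x b] u IH]; first exact: pres_refl.
have -> : ((x, b) :: u) ++ sword_inv ((x, b) :: u) =
          [:: (x, b)] ++ ((u ++ sword_inv u) ++ [:: (x, ~~ b)]).
  by rewrite /sword_inv /= rev_cons -cats1 catA.
apply: pres_trans (pres_cancel x b).
apply: (@pres_cat [:: (x, b)] [:: (x, b)]); first exact: pres_refl.
exact: (@pres_cat _ [::] _ _ IH (pres_refl _)).
Qed.

Lemma pres_mulA : associative pres_mul.
Proof.
move=> a b c.
by rewrite -[a]pres_piK -[b]pres_piK -[c]pres_piK !pres_mulE catA.
Qed.

Lemma pres_mul1 : left_id pres_one pres_mul.
Proof. by move=> a; rewrite -[a]pres_piK pres_mulE. Qed.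

Lemma pres_mulr1 : right_id pres_one pres_mul.
Proof. by move=> a; rewrite -[a]pres_piK pres_mulE cats0. Qed.

Lemma pres_mulrV a : pres_mul a (pres_inv a) = pres_one.
Proof.
by rewrite -{1}[a]pres_piK pres_mulE; apply/pres_piP/sword_mulV.
Qed.

Lemma pres_mulVr a : pres_mul (pres_inv a) a = pres_one.
Proof.
rewrite -{2}[a]pres_piK pres_mulE; apply/pres_piP.
by rewrite -{2}[repr a]sword_invK; apply: sword_mulV.
Qed.

HB.instance Definition _ := isGroup.Build presented
  pres_mulA pres_mul1 pres_mulr1 pres_mulVr pres_mulrV.

Definition pres_gen (x : X) : presented := pres_pi [:: (x, true)].

End Presentation.

(** * Chord diagrams *)

(* The 2n ends are 'I_(2n), that is {0, ..., 2n-1} instead of {1, ..., 2n}. *)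
Record diagram (n : nat) := Diagram {
  chords :> {set {set 'I_n.*2}};
  diagramP : partition chords [set: 'I_n.*2] &&
             [forall p in chords, #|p| == 2] }.

HB.instance Definition _ n := [isSub for @chords n].

Section Classes.
Local Open Scope ring_scope.
Variable N : nat.
Implicit Types (p q : {set 'I_N}) (a b : {set {set 'I_N}}).

(* For p = {p_1, q_1} and q = {p_2, q_2} the product is
   (p_1 - p_2)(p_1 - q_2)(q_1 - p_2)(q_1 - q_2). *)
Definition linked p q : bool :=
  \prod_(i in p) \prod_(j in q) ((i : nat)%:Z - (j : nat)%:Z) < 0.

Definition g p b : nat := #|[set q in b | linked p q]|.

Definition odd_chords b : {set {set 'I_N}} := [set p in b | odd (g p b)].

(* The union of the a_i for i < k. *)
Fixpoint below a (k : nat) : {set {set 'I_N}} :=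
  if k is k'.+1 then below a k' :|: odd_chords (a :\: below a k') else set0.

Definition cls a (k : nat) := odd_chords (a :\: below a k).
Definition cls' a k := odd_chords (cls a k).
Definition cls'' a k := cls a k :\: cls' a k.
Definition cls_top a (m : nat) := a :\: below a m.

Lemma belowE a k : below a k = \bigcup_(i < k) cls a i.
Proof.
by elim: k => [|k IH]; [rewrite big_ord0|rewrite big_ord_recr /= -IH].
Qed.

End Classes.

(** * The group G and the word of a diagram *)

(* The letters a'_i, a''_i (i < m) and a_m. *)
Variant letter (m : nat) := Lprime of 'I_m | Lsecond of 'I_m | Ltop.
Arguments Ltop {m}.

Section Letters.
Variable m : nat.

Definition letter_code (x : letter m) : 'I_m + 'I_m + unit :=
  match x with
  | Lprime i => inl (inl i) | Lsecond i => inl (inr i) | Ltop => inr tt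
  end.
Definition letter_decode (x : 'I_m + 'I_m + unit) : letter m :=
  match x with
  | inl (inl i) => Lprime i | inl (inr i) => Lsecond i | inr _ => Ltop
  end.
Lemma letter_codeK : cancel letter_code letter_decode.
Proof. by case. Qed.
HB.instance Definition _ := Finite.copy (letter m) (can_type letter_codeK).

Local Notation pos s := [seq (x, true) | x <- s].

Inductive Grels : seq (letter m * bool) -> seq (letter m * bool) -> Prop :=
| Grel_sq x : Grels (pos [:: x; x]) [::]
| Grel_second_prime (i j : 'I_m) of (i < j)%N :
    Grels (pos [:: Lsecond i; Lprime j]) (pos [:: Lprime j; Lprime i])
| Grel_second_second (i j : 'I_m) of (i < j)%N :
    Grels (pos [:: Lsecond i; Lsecond j]) (pos [:: Lsecond j; Lprime i])
| Grel_top (i : 'I_m) :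
    Grels (pos [:: Lprime i; Ltop]) (pos [:: Ltop; Lsecond i]).

Definition G : groupType := presented Grels.
Definition Ggen (x : letter m) : G := pres_gen Grels x.

Section Word.
Variables (n : nat) (c : diagram n).

Definition chord_class (x : letter m) : {set {set 'I_n.*2}} :=
  match x with
  | Lprime i => cls' c i | Lsecond i => cls'' c i | Ltop => cls_top c m
  end.

(* The default value is irrelevant for a chord of c, see [letter_ofP]. *)
Definition letter_of (p : {set 'I_n.*2}) : letter m :=
  odflt Ltop [pick x : letter m | p \in chord_class x].

Lemma cls_uniq p (i j : nat) : p \in cls c i -> p \in cls c j -> i = j.
Proof.
wlog lij : i j / i <= j => [IH|].
  by case/orP: (leq_total i j) => ? ? ?; [|apply/esym]; apply: IH.
move=> pi; rewrite inE in_setD belowE => /andP[/andP[/negP pj _] _].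
apply/eqP; rewrite eqn_leq lij leqNgt /=; apply/negP => ltij; case: pj.
by apply/bigcupP; exists (Ordinal ltij).
Qed.

Lemma letter_ofP p x : p \in chords c ->
  (p \in chord_class x) = (x == letter_of p).
Proof.
move=> pc.
have ltclsP (i : 'I_m) : p \in cls c i -> p \notin cls_top c m.
  move=> pi; rewrite in_setD negb_and negbK belowE; apply/orP; left.
  by apply/bigcupP; exists i.
have sub' i : p \in cls' c i -> p \in cls c i by rewrite inE => /andP[].
have sub'' i : p \in cls'' c i -> p \in cls c i by rewrite in_setD => /andP[].
have uniq_cls y z : p \in chord_class y -> p \in chord_class z -> y = z.
  case: y z => [i|i|] [j|j|] //= py pz.
  - by congr Lprime; apply/val_inj/cls_uniq; apply: sub'; eassumption.
  - have E : i = j by apply/val_inj; apply: cls_uniq (sub' _ py) (sub'' _ pz).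
    by move: pz; rewrite -E in_setD py.
  - by move: (ltclsP _ (sub' _ py)); rewrite pz.
  - have E : i = j by apply/val_inj; apply: cls_uniq (sub'' _ py) (sub' _ pz).
    by move: py; rewrite E in_setD pz.
  - by congr Lsecond; apply/val_inj/cls_uniq; apply: sub''; eassumption.
  - by move: (ltclsP _ (sub'' _ py)); rewrite pz.
  - by move: (ltclsP _ (sub' _ pz)); rewrite py.
  - by move: (ltclsP _ (sub'' _ pz)); rewrite py.
rewrite /letter_of; case: pickP => [y py|no] /=.
  by apply/idP/eqP => [px|->//]; apply: uniq_cls px py.
have [/bigcupP[i _ pi]|pt] := boolP (p \in \bigcup_(i < m) cls c i).
  have := no (Lprime i); have := no (Lsecond i) => /=.
  by rewrite in_setD pi andbT => /negbFE ->.
by have := no Ltop; rewrite /= in_setD belowE pt pc.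
Qed.

Definition word : seq (letter m) :=
  [seq letter_of (pblock c k) | k <- enum 'I_n.*2].

End Word.

Definition w (c : {n & diagram n}) : G :=
  (\prod_(x <- word (tagged c)) Ggen x)%g.

End Letters.

(** * Reidemeister moves and free knots *)

Section Moves.
Local Open Scope ring_scope.

Local Notation dist i j := (`| (i : nat)%:Z - (j : nat)%:Z |).

(* The renumbering of the ends of the remaining chords is the unique increasing
   map h whose image is the complement of the added ends. *)
Definition move1 n (c : diagram n) (c' : diagram n.+1) : Prop :=
  exists (h : 'I_n.*2 -> 'I_n.+1.*2) (p q : 'I_n.+1.*2),
  [/\ {homo h : i j / (i < j)%N}, dist p q = 1
    & chords c' = [set p; q] |: [set h @: (b : {set _}) | b in chords c]].

Definition adjacent N (p q p' q' : 'I_N) : Prop :=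
  dist (minn p q) (minn p' q') = 1 /\ dist (maxn p q) (maxn p' q') = 1.

Definition move2 n (c : diagram n) (c' : diagram n.+2) : Prop :=
  exists (h : 'I_n.*2 -> 'I_n.+2.*2) (p q p' q' : 'I_n.+2.*2),
  [/\ {homo h : i j / (i < j)%N}, adjacent p q p' q'
    & chords c' =
        [set p; q] |: ([set p'; q'] |:
          [set h @: (b : {set _}) | b in chords c])].

(* T is a set of three chords of c whose ends are r, r', s, s', t, t', with
   r' = r + 1, s' = s + 1, t' = t + 1. The six ends are distinct because there
   are six of them. *)
Definition adjoint_triple n (c : diagram n) (T : {set {set 'I_n.*2}})
    (r r' s s' t t' : 'I_n.*2) : Prop :=
  [/\ T \subset chords c, #|T| = 3%N,
      cover T = [set r; r'; s; s'; t; t'],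
      [/\ r' = r.+1 :> nat, s' = s.+1 :> nat & t' = t.+1 :> nat]
    & [/\ pblock T r != pblock T r', pblock T s != pblock T s'
        & pblock T t != pblock T t']].

(* As the swap f is an involution, {u, v} is a chord of T' iff {f u, f v} is a
   chord of T. *)
Definition move3 n (c c' : diagram n) : Prop :=
  exists (T : {set {set 'I_n.*2}}) (r r' s s' t t' : 'I_n.*2),
  let f := (tperm r r' * tperm s s' * tperm t t')%g in
  adjoint_triple c T r r' s s' t t' /\
  chords c' = (chords c :\: T) :|: [set f @: (b : {set _}) | b in T].

Definition move_rot n (c c' : diagram n) : Prop :=
  chords c' = [set @ordS n.*2 @: (b : {set _}) | b in chords c].

Local Notation mk c := (Tagged diagram c).

Inductive move : {n & diagram n} -> {n & diagram n} -> Prop :=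
| Move1 n (c : diagram n) c' of move1 c c' : move (mk c) (mk c')
| Move2 n (c : diagram n) c' of move2 c c' : move (mk c) (mk c')
| Move3 n (c c' : diagram n) of move3 c c' : move (mk c) (mk c')
| MoveRot n (c c' : diagram n) of move_rot c c' : move (mk c) (mk c').

Definition same_free_knot : {n & diagram n} -> {n & diagram n} -> Prop :=
  clos_refl_sym_trans _ move.

End Moves.

(* Main.v *)
(* A chord p of c is followed through the bits par c k p, the parity of the
   number of chords of the complement of a_0, ..., a_{k-1} linked with p. The
   letter of p depends on these bits only: p lies in a_k for the first k < m
   with bit 1, and then in a'_k iff the bit k+1 is 0. Chords are linked iff the
   sum mod 2 of the comparisons i < j between their ends is 1, so adding a small
   or a doubled chord, or rotating, does not change the bits of the old chords.
   In the third move exactly the three linkings inside the triple T change. The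
   bits of the three chords of T have sum 0 as long as none of them is removed,
   so the first two chords to leave T do so at the same stage k; their letters
   are exchanged by a'_k <-> a''_k, and no other letter changes. The relations of
   G say precisely that the three swapped pairs of letters keep their product. *)
Require Import Defs.
From mathcomp Require Import all_boot all_order all_algebra all_fingroup zify.

Set Implicit Arguments.
Unset Strict Implicit.
Unset Printing Implicit Defensive.

Import Order.TTheory GRing.Theory Num.Theory.

Local Notation "\xor_ ( i 'in' A ) F" := (\big[addb/false]_(i in A) F)
  (at level 36, F at level 36, i, A at level 50).

(** * Parities of sums, and ordered products in a group *)

Section BigOps.

(** Non-vanishing is carried along with the sign so that the lemma can be applied twice to the
    nested product defining [linked]. *)
Lemma prod_lt0 (I : finType) (A : {set I}) (F : I -> int) :
  {in A, forall i, F i != 0}%R ->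
  (\prod_(i in A) F i != 0)%R /\
  (\prod_(i in A) F i < 0)%R = \xor_(i in A) (F i < 0)%R.
Proof.
move=> F0.
apply: (big_rec2 (fun x b => (x != 0)%R /\ (x < 0)%R = b)) => // i x b iA [x0 <-].
have := F0 i iA; move: (F i) x0 => y x0 y0; split; first by rewrite mulf_neq0.
by case: (ltrgt0P y) y0 => // hy _; rewrite ?(pmulr_rlt0 _ hy) ?(nmulr_rlt0 _ hy) //;
  case: (ltrgt0P x) x0.
Qed.

Lemma xor_same (I : finType) (A : {set I}) (b : bool) :
  \xor_(i in A) b = odd #|A| && b.
Proof.
rewrite big_const; elim: #|A| => //= k ->; by case: (odd k); case: b.
Qed.

Lemma odd_sum (I : finType) (A : {set I}) (F : I -> bool) :
  odd (\sum_(i in A) F i) = \xor_(i in A) F i.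
Proof.
by rewrite (big_morph odd oddD erefl); apply: eq_bigr => i _; case: (F i).
Qed.

Variable gT : groupType.
Implicit Types N : nat.

Lemma prod_enum N (F : 'I_N -> gT) :
  (\prod_k F k)%g = (\prod_(k <- enum 'I_N) F k)%g.
Proof. by rewrite enumT [index_enum _]unlock. Qed.

(** The group is not commutative, so a pair of factors can be traded only when they are neighbours;
    positions [i] and [i + 1] are neighbours in the enumeration. *)
Lemma prod_pair N (F F' : 'I_N -> gT) (i i' : 'I_N) :
  i' = i.+1 :> nat -> (forall k, k != i -> k != i' -> F k = F' k) ->
  (F i * F i' = F' i * F' i')%g -> (\prod_k F k = \prod_k F' k)%g.
Proof.
move=> ii' FF' Fii'; rewrite !prod_enum.
have := enum_uniq 'I_N; have ltiN := ltn_ord i; have ltiN' := ltn_ord i'.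
rewrite -(cat_take_drop i (enum 'I_N)) (drop_nth i) ?size_enum_ord //.
rewrite (drop_nth i) ?size_enum_ord -?ii' // !nth_ord_enum.
set s1 := take _ _; set s2 := drop _ _.
rewrite cat_uniq /= !inE !negb_or => /and3P[_ /and3P[i1 i1' _] /and3P[/andP[ii i2] i2' _]].
rewrite !big_cat /= !big_cons !mulgA -(mulgA _ (F i)) Fii' -!mulgA.
have E s : i \notin s -> i' \notin s ->
    (\prod_(k <- s) F k = \prod_(k <- s) F' k)%g.
  move=> is_ i's; apply: eq_big_seq => k ks.
  by apply: FF'; [apply: contraNneq is_ => <-|apply: contraNneq i's => <-].
by rewrite !E.
Qed.

(** The indices in the image of [h], filtered from the enumeration, and the images taken in order
    are both strictly increasing lists with the same members, hence equal. *)
Lemma prod_homo N N' (h : 'I_N -> 'I_N') (F : 'I_N' -> gT) :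
  {homo h : i j / (i < j)%N} -> (forall k, k \notin codom h -> F k = 1%g) ->
  (\prod_k F k = \prod_k F (h k))%g.
Proof.
move=> hh F1.
have -> : (\prod_k F k = \prod_(k <- enum 'I_N' | k \in codom h) F k)%g.
  rewrite prod_enum [RHS]big_mkcond /=; apply: eq_bigr => k _.
  by case: ifP => // /negbT /F1.
rewrite -big_filter prod_enum -(big_map h predT); congr (bigop _ _ _).
have srt M : sorted ltn (map val (enum 'I_M)) by rewrite val_enum_ord iota_ltn_sorted.
have tr : transitive (fun x y : 'I_N' => (x < y)%N) by move=> x y z; apply: ltn_trans.
apply: (irr_sorted_eq tr).
- by move=> x /=; rewrite ltnn.
- apply: sorted_filter => //; have := srt N'; by rewrite sorted_map.
- rewrite sorted_map; have := srt N; rewrite sorted_map.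
  apply: sub_sorted => x y /=; exact: hh.
move=> k; rewrite mem_filter mem_enum andbT.
by apply/codomP/mapP => [[x ->]|[x _ ->]]; exists x => //; rewrite mem_enum.
Qed.

Lemma prod_ordS N (F F' : 'I_N -> gT) : (forall k, F' (ordS k) = F k) ->
  exists x, (\prod_k F' k = (\prod_k F k) ^ x)%g.
Proof.
case: N F F' => [|N] F F' FF'.
  by exists 1%g; rewrite !big_ord0 conjg1.
(* Rotation carries the last factor to the front, which is conjugation by its inverse. *)
exists (F ord_max)^-1%g; rewrite big_ord_recl [in RHS]big_ord_recr /=.
rewrite conjgE invgK mulgK; congr (_ * _)%g.
  rewrite -FF'; congr F'; apply: val_inj; by rewrite /= modnn.
apply: eq_bigr => i _; rewrite -FF'; congr F'; apply: val_inj.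
by rewrite /= modn_small ?ltnS.
Qed.

End BigOps.

(** * Linking and parities *)

Section Linked.
Variable N : nat.
Implicit Types (p q : {set 'I_N}) (c : {set {set 'I_N}}).

Lemma linkedE p q : [disjoint p & q] ->
  linked p q = \xor_(i in p) \xor_(j in q) (i < j).
Proof.
move=> dis.
have ij0 i : i \in p -> {in q, forall j : 'I_N, (i%:Z - j%:Z != 0)%R}.
  move=> ip j jq; rewrite subr_eq0; apply/eqP => -[] /val_inj ij.
  by move/disjointFl: dis => /(_ _ jq); rewrite -ij ip.
rewrite /linked (prod_lt0 _).2; last by move=> i /ij0 /prod_lt0[].
apply: eq_bigr => i /ij0 /prod_lt0[_ ->]; apply: eq_bigr => j _.
by rewrite subr_lt0 ltz_nat.
Qed.

(** Exchanging the roles of [p] and [q] negates each factor, and for a fixed end of [q] the number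
    of factors is the even number [#|p|]. *)
Lemma linkedC p q : ~~ odd #|p| -> linked p q = linked q p.
Proof.
move=> p2; rewrite /linked exchange_big /=; congr (_ < _)%R.
apply: eq_bigr => j _.
rewrite (eq_bigr (fun i : 'I_N => - (j%:Z - i%:Z))%R); last by move=> i _; rewrite opprB.
by rewrite prodrN -signr_odd (negbTE p2) mul1r.
Qed.

Lemma linked_meet p q i : i \in p -> i \in q -> linked p q = false.
Proof.
by move=> ip iq; rewrite /linked (bigD1 i) //= (bigD1 (P := mem q) i) //= subrr !mul0r ltxx.
Qed.

Definition par c k p := odd (g p (c :\: below c k)).

Lemma parE c k p :
  par c k p = \xor_(q in c) ((q \notin below c k) && linked p q).
Proof.
rewrite /par /g -sum1_card -odd_sum; congr odd; rewrite big_mkcond [RHS]big_mkcond.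
by apply: eq_bigr => q _; rewrite !inE; do 3!case: (_ \in _) => //=; case: linked.
Qed.

End Linked.

(** * Letters and the group *)

Section Letter.
Variable m : nat.
Implicit Types (P : nat -> bool) (x y : letter m).

(* Below, [P] stands for the bits [par c ^~ p] of a chord [p]; [alive P k] means
   that [p] is in none of [a_0, ..., a_{k-1}]. *)
Fixpoint alive P k := if k is k'.+1 then alive P k' && ~~ P k' else true.

Lemma alive_le P i k : i <= k -> alive P k -> alive P i.
Proof.
move=> /subnKC <-; elim: (k - i) => [|d IH]; rewrite ?addn0 // addnS /=.
by case/andP=> /IH.
Qed.

Lemma eq_alive P P' k : P =1 P' -> alive P k = alive P' k.
Proof. by move=> PP'; elim: k => //= k ->; rewrite PP'. Qed.

(* [a_i] splits off [a_{i+1}, ...], so that the number of chords of [a_i]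
   linked with a given chord has the parity [P i (+) P i.+1]. *)
Definition is_letter P x :=
  match x with
  | Lprime i => [&& alive P i, P i & ~~ P i.+1]
  | Lsecond i => [&& alive P i, P i & P i.+1]
  | Ltop => alive P m
  end.

Variables (n : nat) (c : diagram n).
Implicit Type p : {set 'I_n.*2}.

Lemma below_alive k p : p \in chords c ->
  (p \notin below c k) = alive (par c ^~ p) k.
Proof.
move=> pc; elim: k => [|k IH] /=; first by rewrite inE.
by rewrite -IH !inE negb_or pc; case: (p \in below c k).
Qed.

Lemma odd_cls k p : p \in chords c ->
  odd (g p (cls c k)) = par c k p (+) par c k.+1 p.
Proof.
move=> pc; rewrite /par.
have -> : g p (c :\: below c k) = g p (cls c k) + g p (c :\: below c k.+1).
  rewrite /g -cardsUI [_ :&: _](_ : _ = set0) ?cards0 ?addn0.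
    apply: eq_card => q; rewrite !inE.
    by case: (q \in below _ _); case: (q \in _); case: odd; case: linked.
  apply/setP => q; rewrite !inE.
  by case: (q \in below _ _); case: (q \in _); case: odd; case: linked.
by rewrite oddD addbK.
Qed.

Lemma mem_cls k p : p \in chords c ->
  (p \in cls c k) = alive (par c ^~ p) k && par c k p.
Proof. by move=> pc; rewrite inE inE pc andbT below_alive. Qed.

Lemma mem_chord_class x p : p \in chords c ->
  (p \in chord_class c x) = is_letter (par c ^~ p) x.
Proof.
move=> pc; case: x => [i|i|] /=.
- by rewrite inE mem_cls // odd_cls // -andbA; case: (par c i p).
- rewrite /cls'' in_setD /cls' [_ \in odd_chords _]inE mem_cls // odd_cls //.
  by case: alive; case: (par c i p) => //=; rewrite negbK andbT.
- by rewrite inE pc andbT below_alive.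
Qed.

Lemma letter_ofE p x : p \in chords c ->
  is_letter (par c ^~ p) x = (x == letter_of m c p).
Proof. by move=> pc; rewrite -letter_ofP // mem_chord_class. Qed.

Lemma letter_ofW p : p \in chords c ->
  is_letter (par c ^~ p) (letter_of m c p).
Proof. by move=> pc; rewrite letter_ofE. Qed.

Lemma eq_is_letter P P' x : P =1 P' -> is_letter P x = is_letter P' x.
Proof. by move=> PP'; case: x => [i|i|] /=; rewrite ?(eq_alive _ PP') ?PP'. Qed.

End Letter.

(** Bits determine letters even across diagrams of different sizes, so comparing words reduces to
    comparing bits. *)
Lemma eq_letter_of m n n' (c : diagram n) (c' : diagram n') p p' :
  p \in chords c -> p' \in chords c' ->
  (forall k, par c k p = par c' k p') -> letter_of m c p = letter_of m c' p'.
Proof.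
move=> pc pc' E; apply/eqP; rewrite -letter_ofE // -(eq_is_letter _ E).
exact: letter_ofW.
Qed.

(** * Relations of G, and letters of three chords whose bits sum to 0 *)

Section Group.
Variable m : nat.
Implicit Types x y : letter m.
Local Open Scope group_scope.

Lemma Ggen_mul x y : Ggen x * Ggen y = pres_pi (@Grels m) [:: (x, true); (y, true)].
Proof. exact: pres_mulE. Qed.

Lemma Ggen_sq x : Ggen x * Ggen x = 1.
Proof. by rewrite Ggen_mul; apply/pres_piP/pres_rel/(Grel_sq x). Qed.

Lemma GgenV x : (Ggen x)^-1 = Ggen x.
Proof. by apply: (mulgI (Ggen x)); rewrite Ggen_sq mulgV. Qed.

(** The stage at which a chord leaves. [Ltop] gets [m], above all other levels, so that the mixed
    relations of G merge into the single rule [Ggen_flip]. *)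
Definition lev x : nat :=
  match x with Lprime i => i | Lsecond i => i | Ltop => m end.

Definition flip x : letter m :=
  match x with Lprime i => Lsecond i | Lsecond i => Lprime i | Ltop => Ltop end.

Lemma flipK : involutive flip. Proof. by case. Qed.

Lemma lev_flip x : lev (flip x) = lev x. Proof. by case: x. Qed.

Lemma lev_max x : lev x <= m.
Proof. by case: x => //= i; apply: ltnW. Qed.

(** Three of the six cases are defining relations; the other three follow by inverting both sides,
    since every generator is its own inverse. *)
Lemma Ggen_flip x y : lev x < lev y -> Ggen x * Ggen y = Ggen y * Ggen (flip x).
Proof.
have E a b c d : Grels [seq (z, true) | z <- [:: a; b]] [seq (z, true) | z <- [:: c; d]] ->
    Ggen a * Ggen b = Ggen c * Ggen d :> G m.
  by rewrite !Ggen_mul => r; apply/pres_piP/pres_rel.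
have F a b c : Ggen a * Ggen b = Ggen b * Ggen c -> Ggen c * Ggen b = Ggen b * Ggen a :> G m.
  by move/(congr1 (fun z => z^-1)); rewrite !invgM !GgenV.
case: x y => [i|i|] [j|j|] //= lij; try by apply: E; constructor.
- by apply/F/E; constructor.
- by apply/F/E; constructor.
- by apply/F/E; constructor.
- by have := ltn_ord j; rewrite ltnNge ltnW.
- by have := ltn_ord j; rewrite ltnNge ltnW.
Qed.

Lemma is_letterP (P : nat -> bool) x : is_letter P x ->
  alive P (lev x) /\ (lev x < m -> P (lev x)).
Proof. by case: x => [i|i|] /=; [case/and3P|case/and3P|rewrite ltnn]. Qed.

Lemma is_letter_same (P P' : nat -> bool) x :
  (forall k, k <= lev x -> P' k = P k) ->
  (lev x < m -> P' (lev x).+1 = P (lev x).+1) ->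
  is_letter P x -> is_letter P' x.
Proof.
move=> PP' PP1; have E k : k <= lev x -> alive P' k = alive P k.
  by elim: k => //= k IH lk; rewrite IH 1?ltnW // PP' // ltnW.
have Ex := E _ (leqnn _); have PPx := PP' _ (leqnn _).
by case: x Ex PPx PP1 {PP' E} => [i|i|] /= -> // -> ->.
Qed.

(** The bit just after the stage of departure is the one that separates a' from a''. *)
Lemma is_letter_flip (P P' : nat -> bool) x : lev x < m ->
  (forall k, k <= lev x -> P' k = P k) -> P' (lev x).+1 = ~~ P (lev x).+1 ->
  is_letter P x -> is_letter P' (flip x).
Proof.
move=> xm PP' PP1; have E k : k <= lev x -> alive P' k = alive P k.
  by elim: k => //= k IH lk; rewrite IH 1?ltnW // PP' // ltnW.
have Ex := E _ (leqnn _); have PPx := PP' _ (leqnn _).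
case: x xm Ex PPx PP1 {PP' E} => [i|i|] /= xm; last by rewrite ltnn in xm.
  by move=> -> -> ->.
by move=> -> -> ->; rewrite negbK.
Qed.

(** As long as [P] survives its bit is 0, so the even sum forces equal bits on [Q] and [R]: they
    leave together or not at all. *)
Lemma alive_third (P Q R : nat -> bool) k :
  (forall k, alive P k -> alive Q k -> alive R k -> P k (+) Q k (+) R k = false) ->
  alive P k -> alive Q k = alive R k.
Proof.
move=> even; elim: k => //= k IH /andP[Pk nPk]; have QR := IH Pk; rewrite -QR.
case Qk: (alive Q k) => //=.
by have := even _ Pk Qk; rewrite -QR Qk (negbTE nPk) => /(_ isT); case: (Q k); case: (R k).
Qed.

(** Since [Q] outlives [P], the third chord [R] leaves together with [P]. Right after that stage [Q]
    is alive and [R] is not, so the deciding bit of [P] changes; the correction to the bits of [Q]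
    vanishes at every stage that matters. *)
Lemma triple_lt (P Q R P' Q' : nat -> bool) x y :
  (forall k, alive P k -> alive Q k -> alive R k -> P k (+) Q k (+) R k = false) ->
  (forall k, P' k = P k (+) (alive Q k (+) alive R k)) ->
  (forall k, Q' k = Q k (+) (alive P k (+) alive R k)) ->
  is_letter P x -> is_letter Q y -> lev x < lev y ->
  is_letter P' (flip x) /\ is_letter Q' y.
Proof.
move=> even P'E Q'E Px Qy xy; have xm := leq_trans xy (lev_max y).
have PR k : alive Q k -> alive P k = alive R k.
  by apply: alive_third => j Qj Pj Rj; rewrite (addbC (Q j)); apply: even.
have [Px1 /(_ xm) Px2] := is_letterP Px; have [Qy1 _] := is_letterP Qy.
have P0 : alive P (lev x).+1 = false by rewrite /= Px2 andbF.
have R0 : alive R (lev x).+1 = false by rewrite -PR // (alive_le xy).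
split.
  apply: is_letter_flip Px => // [k kx|].
    by rewrite P'E (alive_third even) ?addbb ?addbF // (alive_le kx).
  by rewrite P'E R0 (alive_le xy Qy1) addbT.
apply: is_letter_same Qy => [k ky|_]; rewrite Q'E.
  by rewrite PR ?addbb ?addbF // (alive_le ky).
(* At the stage after [lev y] the chord [Q] may be gone and [PR] no longer applies, but [P] and [R]
   both left earlier. *)
have D S : alive S (lev x).+1 = false -> alive S (lev y).+1 = false.
  by apply/contraFF/alive_le/leqW.
by rewrite !D // addbb addbF.
Qed.

(** [P] and [Q] belong to the chords at two neighbouring ends, [R] to the third chord of the triple.
    If the levels differ, only the letter of lower level flips and [Ggen_flip] applies. If they
    agree below [m], both letters flip and the squares suffice; if both are [m], nothing changes. *)
Lemma triple_swap (P Q R P' Q' : nat -> bool) x y x' y' :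
  (forall k, alive P k -> alive Q k -> alive R k -> P k (+) Q k (+) R k = false) ->
  (forall k, P' k = P k (+) (alive Q k (+) alive R k)) ->
  (forall k, Q' k = Q k (+) (alive P k (+) alive R k)) ->
  is_letter P x -> is_letter Q y ->
  (forall z, is_letter P' z = (z == x')) -> (forall z, is_letter Q' z = (z == y')) ->
  Ggen x * Ggen y = Ggen y' * Ggen x'.
Proof.
move=> even P'E Q'E Px Qy Px' Qy'.
have even' k : alive Q k -> alive P k -> alive R k -> Q k (+) P k (+) R k = false.
  by move=> Qk Pk Rk; rewrite (addbC (Q k)); apply: even.
case: (ltngtP (lev x) (lev y)) => xy.
- have [] := triple_lt even P'E Q'E Px Qy xy.
  by rewrite Px' Qy' => /eqP <- /eqP <-; apply: Ggen_flip.
- have [] := triple_lt even' Q'E P'E Qy Px xy.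
  rewrite Px' Qy' => /eqP <- /eqP <-; rewrite [RHS]Ggen_flip ?flipK //.
  by rewrite lev_flip.
have [xm|mx] := ltnP (lev x) m; last first.
  have T z : m <= lev z -> z = Ltop by case: z => // i; rewrite /= leqNgt ltn_ord.
  have [Ex Ey] : x = Ltop /\ y = Ltop by split; apply: T; rewrite -?xy.
  rewrite Ex in Px; rewrite Ey in Qy.
  have: is_letter P' (@Ltop m).
    apply: (is_letter_same _ _ Px) => [k kx|]; last by rewrite ltnn.
    by rewrite P'E (alive_third even) ?addbb ?addbF // (alive_le kx).
  have: is_letter Q' (@Ltop m).
    apply: (is_letter_same _ _ Qy) => [k kx|]; last by rewrite ltnn.
    by rewrite Q'E (alive_third even') ?addbb ?addbF // (alive_le kx).
  by rewrite Px' Qy' Ex Ey => /eqP <- /eqP <-.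
have [Px1 /(_ xm) Px2] := is_letterP Px; have [Qy1] := is_letterP Qy.
rewrite -xy in Qy1 * => /(_ xm) Qy2.
have Rx : alive R (lev x) by rewrite -(alive_third even).
(* Two bits equal to 1 and an even sum leave bit 0 for [R], which therefore survives this stage. *)
have R1 : alive R (lev x).+1.
  by have /= := even _ Px1 Qy1 Rx; rewrite Rx Px2 Qy2 /= => ->.
have P1 : alive P (lev x).+1 = false by rewrite /= Px2 andbF.
have Q1 : alive Q (lev x).+1 = false by rewrite /= Qy2 andbF.
have : is_letter P' (flip x).
  apply: is_letter_flip Px => // [k kx|].
    by rewrite P'E (alive_third even) ?addbb ?addbF // (alive_le kx).
  by rewrite P'E R1 Q1 addbC.
have : is_letter Q' (flip y).
  apply: is_letter_flip Qy => [|k|]; rewrite -xy //.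
    by move=> kx; rewrite Q'E (alive_third even') ?addbb ?addbF // (alive_le kx).
  by rewrite Q'E R1 P1 addbC.
rewrite Px' Qy' => /eqP <- /eqP <-.
case: x y xm xy {Px Qy Px' Qy' Px1 Px2 Qy1 Qy2 Rx R1 P1 Q1} =>
  [i|i|] [j|j|] //= im; try by move/ord_inj=> ->; rewrite ?Ggen_sq.
all: by move=> E; rewrite ?E ltnn in im.
Qed.
End Group.

(** * Chord diagrams and moves *)

Section Diagram.
Variables (n : nat) (c : diagram n).
Implicit Types p q : {set 'I_n.*2}.

Lemma chords_partition : partition c [set: 'I_n.*2].
Proof. by case/andP: (diagramP c). Qed.

Lemma chords_triv : trivIset c.
Proof. by case/and3P: chords_partition. Qed.

Lemma card_chord p : p \in chords c -> #|p| = 2.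
Proof. by case/andP: (diagramP c) => _ /forall_inP H /H /eqP. Qed.

Lemma card_chords : #|c| = n.
Proof.
have := card_uniform_partition (@card_chord) chords_partition.
by rewrite cardsT card_ord; lia.
Qed.

Lemma pblock_chord k : pblock c k \in chords c.
Proof. by rewrite pblock_mem // (cover_partition chords_partition). Qed.

Lemma mem_chord_pblock k : k \in pblock c k.
Proof. by rewrite mem_pblock (cover_partition chords_partition). Qed.

Lemma chord_pblock p k : p \in chords c -> k \in p -> pblock c k = p.
Proof. exact: def_pblock chords_triv. Qed.

Lemma chords_disjoint p q :
  p \in chords c -> q \in chords c -> p != q -> [disjoint p & q].
Proof. by move/trivIsetP: chords_triv; apply. Qed.

Lemma chord_linkedC p q : p \in chords c -> linked p q = linked q p.
Proof. by move=> pc; apply: linkedC; rewrite card_chord. Qed.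

Lemma chord_mem p : p \in chords c -> exists i, i \in p.
Proof. by move=> /card_chord p2; apply/set0Pn; rewrite -card_gt0 p2. Qed.

Lemma chord_linked_imset M (h : 'I_n.*2 -> 'I_M) p :
  p \in chords c -> linked (h @: p) (h @: p) = false.
Proof. by move=> /chord_mem[i ip]; apply: (@linked_meet _ _ _ (h i)); apply: imset_f. Qed.

Lemma chord_linked p : p \in chords c -> linked p p = false.
Proof. by move=> /chord_mem[i ip]; apply: (@linked_meet _ _ _ i). Qed.

Lemma wE m :
  w m (Tagged diagram c) = (\prod_k Ggen (letter_of m c (pblock c k)))%g.
Proof. by rewrite /w /word big_map prod_enum. Qed.

End Diagram.

(** * Diagrams extended by new chords *)

Lemma linked_imset N N' (h : 'I_N -> 'I_N') (p q : {set 'I_N}) :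
  injective h -> [disjoint p & q] ->
  linked (h @: p) (h @: q) = \xor_(i in p) \xor_(j in q) (h i < h j).
Proof.
move=> hI dis; rewrite linkedE ?imset_disjoint //.
rewrite big_imset /=; last by move=> ? ? _ _; apply: hI.
by apply: eq_bigr => i _; rewrite big_imset //= => ? ? _ _; apply: hI.
Qed.

(** The last premise says that at each stage the surviving chords of [E] contribute evenly to every
    old chord. Equal removed sets at stage [k] then give equal bits, and these give equal removed
    sets at stage [k + 1]. *)
Lemma par_ext N N' (c : {set {set 'I_N}}) (c' : {set {set 'I_N'}}) phi (E : {set {set 'I_N'}}) :
  c' = E :|: phi @: c -> [disjoint E & phi @: c] -> {in c &, injective phi} ->
  {in c &, forall p q, linked (phi p) (phi q) = linked p q} ->
  (forall k, {in c, forall p, \xor_(e in E) ((e \notin below c' k) && linked (phi p) e) = false}) ->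
  forall k, {in c, forall p, par c' k (phi p) = par c k p}.
Proof.
move=> c'E dis phiI phiL neutral.
have H k : {in c, forall p, (phi p \in below c' k) = (p \in below c k)} ->
    {in c, forall p, par c' k (phi p) = par c k p}.
  move=> B p pc; rewrite !parE (eq_bigl [in [predU E & phi @: c]]); last first.
    by move=> q; rewrite c'E !inE.
  rewrite bigU //= neutral // addFb.
  by rewrite big_imset //=; apply: eq_bigr => q qc; rewrite B // phiL.
move=> k; apply: (H); elim: k => [|k IH] p pc /=; first by rewrite !inE.
have pc' : phi p \in c' by rewrite c'E inE imset_f ?orbT.
by have := H k IH p pc; rewrite /par !inE IH // pc pc' => ->.
Qed.

Lemma homo_ltn_inj N N' (h : 'I_N -> 'I_N') :
  {homo h : i j / i < j} -> injective h.
Proof.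
move=> hh i j hij; apply/val_inj; case: (ltngtP i j) => // /hh; by rewrite hij ltnn.
Qed.

(** Old chords keep their letters by [par_ext], so the word of [c] is that of [c'] with the letters
    at the added ends erased. *)
Lemma w_ext m n n' (c : diagram n) (c' : diagram n') (h : 'I_n.*2 -> 'I_n'.*2)
    (E : {set {set 'I_n'.*2}}) :
  {homo h : i j / i < j} -> chords c' = E :|: [set h @: (b : {set _}) | b in chords c] ->
  [disjoint E & [set h @: (b : {set _}) | b in chords c]] ->
  (forall k (p : {set _}), p \in chords c ->
     \xor_(e in E) ((e \notin below c' k) && linked (h @: p) e) = false) ->
  w m (Tagged diagram c) =
  (\prod_k (if k \in cover E then 1 else Ggen (letter_of m c' (pblock c' k))))%g.
Proof.
move=> hh c'E dis neutral; have hI := homo_ltn_inj hh.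
have homoE i j : (h i < h j) = (i < j).
  case: (ltngtP i j) => [/hh //|/hh /ltnW|/val_inj ->]; last exact: ltnn.
  by rewrite leqNgt => /negbTE.
have parh k (p : {set _}) : p \in chords c -> par c' k (h @: p) = par c k p.
  move: k p; apply: par_ext dis _ _ neutral => //.
    by move=> p q _ _; apply: imset_inj.
  move=> p q pc qc; have [->|pq] := eqVneq p q.
    by rewrite (chord_linked_imset _ qc) (chord_linked qc).
  rewrite linked_imset ?(chords_disjoint pc) // linkedE ?(chords_disjoint pc) //.
  by do 2!apply: eq_bigr => ? _; apply: homoE.
have im p : p \in chords c -> h @: p \in chords c'.
  by move=> pc; rewrite c'E inE; apply/orP; right; apply/imsetP; exists p.
rewrite wE [RHS](prod_homo hh); last first.
  (* An end outside the image of [h] must lie on an added chord, where the factor is 1. *)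
  move=> k /codomP kh; rewrite ifT //; apply/bigcupP; exists (pblock c' k); last exact: mem_chord_pblock.
  have : pblock c' k \in E :|: [set h @: (b : {set _}) | b in chords c].
    by rewrite -c'E pblock_chord.
  rewrite inE => /orP[//|/imsetP[p pc Ep]].
  by case: kh; have := mem_chord_pblock c' k; rewrite Ep => /imsetP[i _ ->]; exists i.
apply: eq_bigr => k _.
have hk : pblock c' (h k) = h @: pblock c k.
  by apply: chord_pblock; rewrite ?im ?pblock_chord // imset_f // mem_chord_pblock.
rewrite ifF.
  by rewrite hk; congr Ggen; apply: eq_letter_of; rewrite ?im ?pblock_chord // => j; rewrite parh // pblock_chord.
apply/negP => /bigcupP[e eE]; have ec' : e \in chords c' by rewrite c'E inE eE.
move=> he; move: eE; rewrite -(chord_pblock ec' he) hk => eE.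
have := disjointFr dis eE => /negP[]; apply/imsetP; exists (pblock c k) => //.
exact: pblock_chord.
Qed.

(** A count: [c'] has at least [n + #|E|] chords, and the image of [c] supplies at most [n], which
    leaves no room for an overlap. *)
Lemma added_disjoint n n' (c : diagram n) (c' : diagram n')
    (phi : {set 'I_n.*2} -> {set 'I_n'.*2}) (E : {set {set _}}) :
  n + #|E| <= n' -> chords c' = E :|: [set phi b | b in chords c] ->
  [disjoint E & [set phi b | b in chords c]].
Proof.
move=> En c'E; rewrite -setI_eq0 -cards_eq0; set A := [set _ | _ in _] in c'E *.
have An : #|A| <= n by rewrite -[X in _ <= X](card_chords c) leq_imset_card.
have := cardsU E A; rewrite -c'E card_chords; have := subset_leq_card (subsetIl E A).
move: En An; set x := #|E :&: A|; set y := #|E|; set z := #|A|; clearbody x y z; lia.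
Qed.

Lemma added_chord_disjoint n n' (c : diagram n) (c' : diagram n')
    (phi : {set 'I_n.*2} -> {set 'I_n'.*2}) (E : {set {set _}}) e b :
  chords c' = E :|: [set phi b | b in chords c] ->
  [disjoint E & [set phi b | b in chords c]] ->
  e \in E -> b \in chords c -> [disjoint phi b & e].
Proof.
move=> c'E dis eE bc; have pb : phi b \in [set phi b | b in chords c] by exact: imset_f.
apply: (chords_disjoint (c := c')); rewrite ?c'E ?inE ?eE ?pb ?orbT //.
by apply: contraTneq eE => <-; rewrite (disjointFl dis).
Qed.

(** * First and second moves *)

Definition near N (i j : 'I_N) := (j == i.+1 :> nat) || (i == j.+1 :> nat).

Lemma nearC N (i j : 'I_N) : near i j = near j i.
Proof. exact: orbC. Qed.

Lemma near_neq N (i j : 'I_N) : near i j -> i != j.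
Proof. by rewrite /near -!val_eqE /=; lia. Qed.

Lemma dist1_near N (i j : 'I_N) : (`| i%:Z - j%:Z | = 1)%R -> near i j.
Proof. by rewrite /near; lia. Qed.

Lemma prod_erase (gT : groupType) N (F : 'I_N -> gT) i j : near i j ->
  F i = F j -> (F i * F i = 1)%g ->
  (\prod_k F k = \prod_k if k \in [set i; j] then 1 else F k)%g.
Proof.
wlog ij : i j / j = i.+1 :> nat => [IH nij Fij Fi|_ Fij Fi].
  case/orP: (nij) => /eqP E; first exact: IH.
  by rewrite (IH j i) 1?nearC -?Fij // setUC.
apply: (prod_pair ij) => [k ki kj|].
  by rewrite !inE (negbTE ki) (negbTE kj).
by rewrite !inE !eqxx orbT -Fij Fi mulg1.
Qed.

Lemma xor_pair (I : finType) (a b : I) (F : I -> bool) : a != b ->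
  \xor_(i in [set a; b]) F i = F a (+) F b.
Proof. by move=> ab; rewrite big_setU1 ?inE // big_set1. Qed.

Lemma card2_neq (I : finType) (a b : I) : #|[set a; b]| = 2 -> a != b.
Proof. by rewrite cards2; case: eqVneq. Qed.

(** An end of [p] contributes exactly when it separates [a] from [b]. *)
Lemma linked_pair N (p : {set 'I_N}) a b : a != b -> [disjoint p & [set a; b]] ->
  linked p [set a; b] = \xor_(i in p) ((i < a) (+) (i < b)).
Proof.
by move=> ab dis; rewrite linkedE //; apply: eq_bigr => i _; rewrite xor_pair.
Qed.

Lemma near_gt N (i j k : 'I_N) : near i j -> k != i -> k != j -> (k < i) = (k < j).
Proof. by rewrite /near -!val_eqE /=; lia. Qed.

Lemma disjoint_pair (I : finType) (p : {set I}) a b i :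
  [disjoint p & [set a; b]] -> i \in p -> (i != a) && (i != b).
Proof. by move=> dis ip; have := disjointFr dis ip; rewrite !inE => /negbT; rewrite negb_or. Qed.

Lemma move1_w m n (c : diagram n) (c' : diagram n.+1) : move1 c c' ->
  w m (Tagged diagram c) = w m (Tagged diagram c').
Proof.
case=> h [p [q [hh /dist1_near pq c'E]]].
set P := [set p; q] in c'E.
have Pc' : P \in chords c' by rewrite c'E !inE eqxx.
have dis : [disjoint [set P] & [set h @: (b : {set _}) | b in chords c]].
  by apply: (added_disjoint _ c'E); rewrite cards1 addn1.
rewrite (w_ext m hh c'E dis) => [|k b bc].
  rewrite wE [RHS](prod_erase pq).
  - by apply: eq_bigr => k _; rewrite cover1.
  - by rewrite !(chord_pblock Pc') ?inE ?eqxx ?orbT.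
  - exact: Ggen_sq.
(* No end of an old chord separates two neighbouring ends, so the small chord is linked with none of
   them. *)
have dP := added_chord_disjoint c'E dis (set11 P) bc.
rewrite big_set1 linked_pair ?near_neq // big1 ?andbF // => i /(disjoint_pair dP)/andP[ip iq].
by rewrite (near_gt pq) ?addbb.
Qed.

(** Induction on the stage: if both are present or both removed, the contributions of other chords
    agree by [L], and those of [P] and [P'] to each other agree by symmetry of linking. *)
Lemma par_twins n (c : diagram n) P P' : P \in chords c -> P' \in chords c -> P != P' ->
  (forall q, q \in chords c -> q != P -> q != P' -> linked P q = linked P' q) ->
  forall k, par c k P = par c k P'.
Proof.
move=> Pc P'c PP' L.
have S F : \xor_(q in chords c) F q = F P (+) (F P' (+)
    \big[addb/false]_(q in chords c | (q != P) && (q != P')) F q).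
  rewrite (bigD1 P) // (bigD1 P') /= ?P'c 1?eq_sym //; do 2!congr (_ (+) _).
  by apply: eq_bigl => q; rewrite andbA.
have H k : (P \in below c k) = (P' \in below c k) -> par c k P = par c k P'.
  move=> B; rewrite !parE !S (chord_linked Pc) (chord_linked P'c).
  rewrite (chord_linkedC _ Pc) B andbF addFb; congr (_ (+) _).
  by apply: eq_bigr => q /and3P[qc qP qP']; rewrite L.
move=> k; apply: (H); elim: k => [|k IH] /=; first by rewrite !inE.
by have := H k IH; rewrite /par !inE IH Pc P'c => ->.
Qed.

Lemma adjacent_near N (p q p' q' : 'I_N) : adjacent p q p' q' ->
  exists a b a' b', [/\ [set p; q] = [set a; b], [set p'; q'] = [set a'; b'],
    near a a' & near b b'].
Proof.
have E (x y : 'I_N) : exists a b : 'I_N,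
    [/\ [set x; y] = [set a; b], minn x y = a & maxn x y = b].
  case: (leqP x y) => _; first by exists x, y.
  by exists y, x; rewrite setUC.
have [a [b [-> pa pb]]] := E p q; have [a' [b' [-> pa' pb']]] := E p' q'.
by rewrite /adjacent pa pb pa' pb' => -[/dist1_near ? /dist1_near ?]; exists a, b, a', b'.
Qed.

Lemma move2_w m n (c : diagram n) (c' : diagram n.+2) : move2 c c' ->
  w m (Tagged diagram c) = w m (Tagged diagram c').
Proof.
case=> h [p [q [p' [q' [hh /adjacent_near[a [b [a' [b' [-> -> aa' bb']]]]]]]]]].
set P := [set a; b]; set P' := [set a'; b']; rewrite setUA => c'E.
have Pc' : P \in chords c' by rewrite c'E !inE eqxx.
have P'c' : P' \in chords c' by rewrite c'E !inE eqxx orbT.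
have ab : a != b by apply/card2_neq/(card_chord Pc').
have ab' : a' != b' by apply/card2_neq/(card_chord P'c').
have dis : [disjoint [set P; P'] & [set h @: (b : {set _}) | b in chords c]].
  by apply: (added_disjoint _ c'E); rewrite cards2; case: eqVneq; lia.
have PP' : P != P'.
  (* Equal new chords would leave at most [n + 1] chords in a diagram of [n + 2]. *)
  apply/eqP => PP'; have: #|c'| <= n.+1.
    rewrite c'E PP' setUid cardsU1; apply: (leq_add (leq_b1 _)).
    by rewrite -[X in _ <= X](card_chords c) leq_imset_card.
  by rewrite card_chords ltnn.
have dPP' := chords_disjoint Pc' P'c' PP'.
have twins k : par c' k P = par c' k P'.
  apply: par_twins => // e ec' eP eP'.
  rewrite (chord_linkedC _ Pc') (chord_linkedC _ P'c').
  have dP := chords_disjoint ec' Pc' eP; have dP' := chords_disjoint ec' P'c' eP'.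
  rewrite !linked_pair //; apply: eq_bigr => i ie.
  have /andP[ia ib] := disjoint_pair dP ie; have /andP[ia' ib'] := disjoint_pair dP' ie.
  by rewrite (near_gt aa') // (near_gt bb').
have PL : letter_of m c' P = letter_of m c' P' by apply: eq_letter_of.
rewrite (w_ext m hh c'E dis) => [|k e ec].
  set F := fun k => Ggen (letter_of m c' (pblock c' k)).
  have Fa : F a = Ggen (letter_of m c' P) by rewrite /F (chord_pblock Pc') // !inE eqxx.
  have Fb : F b = Ggen (letter_of m c' P) by rewrite /F (chord_pblock Pc') // !inE eqxx orbT.
  have Fa' : F a' = Ggen (letter_of m c' P) by rewrite PL /F (chord_pblock P'c') // !inE eqxx.
  have Fb' : F b' = Ggen (letter_of m c' P) by rewrite PL /F (chord_pblock P'c') // !inE eqxx orbT.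
  (* The second cancellation takes place in the product where [a] and [a'] are already erased, so
     [b] and [b'] must differ from them. *)
  have baa' : b \notin [set a; a'].
    have bP : b \in P by rewrite !inE eqxx orbT.
    by rewrite !inE negb_or eq_sym ab; have /andP[] := disjoint_pair dPP' bP.
  have b'aa' : b' \notin [set a; a'].
    have bP : b' \in P' by rewrite !inE eqxx orbT.
    rewrite disjoint_sym in dPP'.
    by rewrite !inE negb_or (eq_sym _ a') ab' andbT; have /andP[] := disjoint_pair dPP' bP.
  have -> : w m (Tagged diagram c') = (\prod_k F k)%g by apply: wE.
  rewrite [RHS](prod_erase aa') ?Fa ?Fa' ?Ggen_sq //.
  rewrite [RHS](prod_erase bb') ?(negbTE baa') ?(negbTE b'aa') ?Fb ?Fb' ?Ggen_sq //.
  apply: eq_bigr => k _; rewrite -/(F k).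
  have -> : cover [set P; P'] = [set a; a'] :|: [set b; b'].
    by rewrite /cover big_setU1 ?inE // big_set1 /P /P' setUACA.
  by rewrite inE; case: (k \in [set a; a']); case: (k \in [set b; b']).
(* The twins leave at the same stage and are linked with the same old chords, so their contributions
   cancel. *)
have dP := added_chord_disjoint c'E dis (set21 P P') ec.
have dP' := added_chord_disjoint c'E dis (set22 P P') ec.
rewrite xor_pair // !(below_alive, linked_pair) //.
rewrite (eq_alive _ twins) -andb_addr -big_split big1 ?andbF // => i ie.
have /andP[ia ib] := disjoint_pair dP ie; have /andP[ia' ib'] := disjoint_pair dP' ie.
by rewrite /= (near_gt aa') // (near_gt bb') // addbb.
Qed.

(** * Change of the initial point *)

Lemma ordS_lt N (i j : 'I_N) : i != j ->
  (ordS i < ordS j) = (i < j) (+) ((i.+1 == N) (+) (j.+1 == N)).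
Proof.
rewrite -val_eqE /= => ij.
have E (k : 'I_N) : k.+1 %% N = if k.+1 == N then 0 else k.+1.
  case: eqVneq => [->|kN]; first exact: modnn.
  by rewrite modn_small // ltn_neqAle kN ltn_ord.
rewrite !E; have := ltn_ord i; have := ltn_ord j.
case: (eqVneq i.+1 N) => iN; case: (eqVneq j.+1 N) => jN /=; lia.
Qed.

Lemma move_rot_w m n (c c' : diagram n) : move_rot c c' ->
  exists x, w m (Tagged diagram c') = (w m (Tagged diagram c) ^ x)%g.
Proof.
rewrite /move_rot; set h := @ordS n.*2 => c'E; have hI : injective h := @ordS_inj _.
have im p : p \in chords c -> h @: p \in chords c'.
  by move=> pc; rewrite c'E; apply/imsetP; exists p.
have L : forall k (p : {set _}), p \in chords c -> par c' k (h @: p) = par c k p.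
  apply: (par_ext (E := set0)).
  - by rewrite set0U.
  - by rewrite disjoints_subset sub0set.
  - by move=> p q _ _; apply: imset_inj.
  - move=> p q pc qc; have [->|pq] := eqVneq p q.
      by rewrite (chord_linked_imset _ qc) (chord_linked qc).
    have dis := chords_disjoint pc qc pq.
    rewrite linked_imset // linkedE //.
    (* Each correction from [ordS_lt] depends on one end only, so summing it over the two ends of
       the other chord gives 0. *)
    under eq_bigr => i ip.
      under eq_bigr => j jq.
        rewrite ordS_lt; last by apply: contraTneq jq => <-; rewrite (disjointFr dis).
        over.
      rewrite !big_split /= xor_same (card_chord qc) andFb addFb. over.
    by rewrite big_split /= xor_same (card_chord pc) andFb addbF.
  by move=> k p _; rewrite big_set0.
rewrite !wE; apply: prod_ordS => k; congr Ggen.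
rewrite (chord_pblock (p := h @: pblock c k)) ?im ?pblock_chord //; last first.
  by rewrite imset_f // mem_chord_pblock.
by apply/esym/eq_letter_of; rewrite ?im ?pblock_chord // => j; rewrite L // pblock_chord.
Qed.

(** * Involutions that swap neighbouring ends *)

Section Swap.
Variables (N : nat) (f : 'I_N -> 'I_N).
Hypotheses (fK : involutive f) (f_le : forall i, f i <= i.+1).

Lemma swap_lt i j : i != j -> (f i < f j) = (i < j) (+) (j == f i).
Proof.
(* With [fK], the bound [f_le] also holds in the other direction: [f] moves every index by at most
   one. *)
have ge (k : 'I_N) : k <= (f k).+1 by rewrite -{1}[k]fK.
have := congr1 val (fK i); have := congr1 val (fK j).
have : (f i == f j) = (i == j) by apply: inj_eq; apply: inv_inj.
have : (f i == j) = (i == f j) by rewrite -{2}[i]fK (inj_eq (inv_inj fK)).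
have := f_le i; have := f_le j; have := ge i; have := ge j.
rewrite -!val_eqE /=; lia.
Qed.

Lemma linked_swap (p q : {set 'I_N}) : [disjoint p & q] ->
  linked (f @: p) (f @: q) = linked p q (+) \xor_(i in p) \xor_(j in q) (j == f i).
Proof.
move=> dis; rewrite linked_imset // ?linkedE //; last exact: inv_inj.
rewrite -big_split; apply: eq_bigr => i ip; rewrite -big_split; apply: eq_bigr => j jq.
by rewrite swap_lt //; apply: contraTneq jq => <-; rewrite (disjointFr dis).
Qed.

(** The moved indices fall into pairs [i], [f i] of neighbours, and both members of a pair lie on
    the same side of the fixed index [j]. *)
Lemma swap_even j : f j = j -> \xor_(i in [set k | f k != k]) (i < j) = false.
Proof.
move=> fj; rewrite (bigID (fun i : 'I_N => i < f i)) /= [X in _ (+) X](reindex_inj (inv_inj fK)) /=.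
have E (i : 'I_N) : (f i \in [set k | f k != k]) && ~~ (f i < f (f i)) =
    (i \in [set k | f k != k]) && (i < f i).
  by rewrite !inE fK eq_sym -leqNgt leq_eqVlt val_eqE; case: eqVneq; rewrite ?ltnn.
rewrite (eq_bigl _ _ E) -big_split big1 //= => i /andP[]; rewrite inE => fi _.
have ij : i != j by apply: contraNneq fi => ->; rewrite fj.
have jfi : (j == f i) = false.
  by apply/eqP => jfi; move: ij; rewrite -[i]fK -jfi fj eqxx.
by have := swap_lt ij; rewrite fj jfi addbF => ->; rewrite addbb.
Qed.

End Swap.

Lemma cards3P (I : finType) (T : {set I}) a b : #|T| = 3 -> a \in T -> b \in T -> a != b ->
  exists2 c, (c != a) && (c != b) & T = a |: [set b; c].
Proof.
move=> T3 aT bT ab; have : #|T :\: [set a; b]| = 1.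
  by rewrite cardsD (setIidPr _) ?T3 ?cards2 ?ab // subUset !sub1set aT.
move/eqP/cards1P => [c Tc]; exists c.
  have : c \in T :\: [set a; b] by rewrite Tc set11.
  by rewrite !inE negb_or => /andP[].
by rewrite setUA -Tc; apply/setP => x; rewrite !inE; do 2?case: eqVneq => [->|_] //=; rewrite ?aT ?bT.
Qed.

(** * Bits and letters under the third move *)

Section TripleMove.
Variables (n : nat) (c c' : diagram n) (T : {set {set 'I_n.*2}}).
Variable f : 'I_n.*2 -> 'I_n.*2.
Hypotheses (fK : involutive f) (f_le : forall i, f i <= i.+1).
Hypotheses (Tc : T \subset chords c) (T3 : #|T| = 3).
Hypothesis coverT : cover T = [set k | f k != k].
Hypothesis fT : forall (p : {set 'I_n.*2}) k, p \in T -> k \in p -> f k \notin p.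
Hypothesis c'E : chords c' = [set f @: (b : {set _}) | b in chords c].
Implicit Types p q : {set 'I_n.*2}.

Let Tchord p : p \in T -> p \in chords c. Proof. by move/subsetP: Tc; apply. Qed.

Let memT p i : p \in T -> i \in p -> i \in cover T.
Proof. by move=> pT ip; apply/bigcupP; exists p. Qed.

Let Ttriv : trivIset T. Proof. exact: trivIsetS Tc (chords_triv c). Qed.

Lemma triple_third p q : p \in T -> q \in T -> p != q ->
  exists r, [/\ r \in T, r != p, r != q & T = p |: [set q; r]].
Proof.
move=> pT qT pq; have [r /andP[rp rq] E] := cards3P T3 pT qT pq.
by exists r; split=> //; rewrite E !inE eqxx !orbT.
Qed.

Lemma big_triple R (idx : R) (op : Monoid.com_law idx) (F : {set 'I_n.*2} -> R) p q r :
  p != q -> r != p -> r != q -> T = p |: [set q; r] ->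
  \big[op/idx]_(x in T) F x = op (F p) (op (F q) (F r)).
Proof.
move=> pq rp rq ->; rewrite big_setU1 ?inE ?negb_or ?pq 1?eq_sym //=.
by rewrite big_setU1 ?inE 1?eq_sym // big_set1.
Qed.

(* Each chord of [T] is joined by two swapped pairs to the other two chords,
   which forces exactly one pair between any two of them. *)
Let joins p q := \sum_(i in p) \sum_(j in q) (j == f i).

Let joinsC p q : joins p q = joins q p.
Proof.
rewrite /joins exchange_big; apply: eq_bigr => j _; apply: eq_bigr => i _.
by rewrite -{2}[i]fK (inj_eq (inv_inj fK)) eq_sym.
Qed.

Let joins_self p : p \in T -> joins p p = 0.
Proof.
move=> pT; apply: big1 => i ip; apply: big1 => j jp.
by case: eqP => // jfi; have := fT pT ip; rewrite -jfi jp.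
Qed.

Let joins_sum p : p \in T -> \sum_(q in T) joins p q = 2.
Proof.
move=> pT; rewrite -(card_chord (Tchord pT)) -sum1_card exchange_big.
apply: eq_bigr => i ip; rewrite -(big_trivIset _ Ttriv) /=.
rewrite (bigD1 (f i)) /= ?eqxx ?big1 // => [j /andP[_ /negbTE ->] //|].
by have := memT pT ip; rewrite coverT !inE fK eq_sym.
Qed.

Lemma joins1 p q : p \in T -> q \in T -> p != q -> joins p q = 1.
Proof.
move=> pT qT pq; have [r [rT rp rq E]] := triple_third pT qT pq.
have J := big_triple _ _ pq rp rq E.
have := joins_sum pT; have := joins_sum qT; have := joins_sum rT.
rewrite !J !joins_self // (joinsC q p) (joinsC r p) (joinsC r q) /=; lia.
Qed.

(** Linking changes by the parity of [joins p q]: this is 1 for two different chords of [T], and 0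
    as soon as one chord is outside [T], because [f] fixes its ends. *)
Lemma linked_triple p q : p \in chords c -> q \in chords c ->
  linked (f @: p) (f @: q) = linked p q (+) [&& p \in T, q \in T & p != q].
Proof.
move=> pc qc; have [<-|pq] := eqVneq p q.
  by rewrite (chord_linked_imset _ pc) (chord_linked pc) !andbF.
have dis := chords_disjoint pc qc pq.
rewrite linked_swap // andbT; congr (_ (+) _).
have -> : \xor_(i in p) \xor_(j in q) (j == f i) = odd (joins p q).
  rewrite /joins (big_morph odd oddD erefl); apply: eq_bigr => i _.
  by rewrite odd_sum.
have fix_out x i : x \in chords c -> x \notin T -> i \in x -> f i = i.
  move=> xc xT ix; apply: contraNeq xT => fi.
  have : i \in cover T by rewrite coverT inE.
  by case/bigcupP => y yT iy; rewrite -(chord_pblock xc ix) (chord_pblock (Tchord yT) iy).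
have [pT|pT] := boolP (p \in T); last first.
  rewrite /joins big1 // => i ip; rewrite big1 // => j jq.
  by rewrite (fix_out p) //; case: eqP => // ji; rewrite -ji (disjointFl dis) in ip.
have [qT|qT] := boolP (q \in T); first by rewrite joins1.
rewrite joinsC /joins big1 // => i iq; rewrite big1 // => j jp.
by rewrite (fix_out q) //; case: eqP => // ji; rewrite -ji (disjointFr dis) in iq.
Qed.

(** The sum of the three bits is regrouped by the linking chord. A chord outside [T] contributes 0
    by [swap_even], and each linking inside [T] is counted twice. *)
Lemma triple_even k p q r :
  p \in T -> q \in T -> p != q -> r != p -> r != q -> T = p |: [set q; r] ->
  alive (par c ^~ p) k -> alive (par c ^~ q) k -> alive (par c ^~ r) k ->
  par c k p (+) par c k q (+) par c k r = false.
Proof.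
move=> pT qT pq rp rq E; have rT : r \in T by rewrite E !inE eqxx !orbT.
rewrite -!below_alive ?Tchord // => pk qk rk.
have B F : \xor_(x in T) F x = F p (+) (F q (+) F r) by apply: big_triple.
rewrite -addbA -B; under eq_bigr => x _ do rewrite parE.
rewrite exchange_big /= (bigID (mem T)) /= [X in _ (+) X]big1 ?addbF; last first.
  move=> x /andP[xc xT]; rewrite -big_distrr /=.
  suff -> : \xor_(i in T) linked i x = false by rewrite andbF.
  under eq_bigr => y yT.
    rewrite linkedE; last first.
      by apply: (chords_disjoint (Tchord yT) xc); apply: contraNneq xT => <-.
    over.
  rewrite -(big_trivIset _ Ttriv) /= exchange_big big1 //= => j jx.
  rewrite coverT swap_even //; apply/eqP; apply: contraNT xT => fj.
  have : j \in cover T by rewrite coverT inE.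
  by case/bigcupP => y yT jy; rewrite -(chord_pblock xc jx) (chord_pblock (Tchord yT) jy).
rewrite (eq_bigl [in T]); last first.
  by move=> x; rewrite /= andb_idl // => /Tchord.
rewrite !B pk qk rk /= !(chord_linked (c := c)) ?Tchord //.
rewrite (chord_linkedC _ (Tchord qT)) !(chord_linkedC _ (Tchord rT)).
by case: (linked p q); case: (linked p r); case: (linked q r).
Qed.

Lemma triple_alive k p q r :
  p \in T -> q \in T -> p != q -> r != p -> r != q -> T = p |: [set q; r] ->
  alive (par c ^~ p) k -> alive (par c ^~ q) k = alive (par c ^~ r) k.
Proof. by move=> pT qT pq rp rq E; apply: alive_third => j; apply: triple_even. Qed.

Let im p : p \in chords c -> f @: p \in chords c'.
Proof. by move=> pc; rewrite c'E; apply/imsetP; exists p. Qed.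

Let par_below k : (forall p, p \in chords c -> (f @: p \in below c' k) = (p \in below c k)) ->
  forall p, p \in chords c ->
  par c' k (f @: p) = par c k p (+)
    \xor_(q in T) [&& q \notin below c k, p \in T & p != q].
Proof.
move=> B p pc; rewrite !parE.
rewrite (eq_bigl [in [set f @: (b : {set _}) | b in chords c]]); last by move=> q; rewrite c'E.
rewrite big_imset /=; last by move=> ? ? _ _; apply/imset_inj/inv_inj.
have -> : \xor_(q in T) [&& q \notin below c k, p \in T & p != q] =
    \xor_(q in chords c) ((q \notin below c k) && [&& p \in T, q \in T & p != q]).
  rewrite [RHS](bigID (mem T)) /= [X in _ (+) X]big1 ?addbF; last first.
    by move=> q /andP[_ /negbTE ->]; rewrite !andbF.
  apply: eq_big => q; first by rewrite andb_idl // => /Tchord.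
  by move=> ->.
rewrite -big_split; apply: eq_bigr => q qc /=.
by rewrite B // linked_triple // andb_addr.
Qed.

Let xor_alive k p q r :
  p \in T -> q \in T -> p != q -> r != p -> r != q -> T = p |: [set q; r] ->
  \xor_(x in T) [&& x \notin below c k, p \in T & p != x] =
  alive (par c ^~ q) k (+) alive (par c ^~ r) k.
Proof.
move=> pT qT pq rp rq E; have rT : r \in T by rewrite E !inE eqxx !orbT.
rewrite (big_triple _ _ pq rp rq E) !below_alive ?Tchord //.
by rewrite pT eqxx pq (eq_sym p) rp !andbT andbF.
Qed.

(** The correction to the bit of a surviving chord of [T] is 0, as the other two are both present or
    both gone. Hence every chord leaves at the same stage before and after the move. *)
Let below_triple k p : p \in chords c -> (f @: p \in below c' k) = (p \in below c k).
Proof.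
elim: k p => [|k IH] p pc; first by rewrite !inE.
have := par_below IH pc; rewrite /par /= !inE IH // im // pc => ->.
have [//|pk /=] := boolP (p \in below c k).
suff -> : \xor_(q in T) [&& q \notin below c k, p \in T & p != q] = false by rewrite addbF.
have [pT|pT] := boolP (p \in T); last by rewrite big1 // => q _; rewrite !andbF.
have [q] : exists q, q \in T :\ p.
  by apply/set0Pn; rewrite -card_gt0; have := cardsD1 p T; rewrite T3 pT => -[]; rewrite add0n => <-.
rewrite !inE eq_sym => /andP[pq qT].
have [r [rT rp rq E]] := triple_third pT qT pq.
have := xor_alive k pT qT pq rp rq E; rewrite pT => ->.
by rewrite (triple_alive pT qT pq rp rq E) ?addbb // -below_alive.
Qed.

Lemma par_notin_triple k p : p \in chords c -> p \notin T -> par c' k (f @: p) = par c k p.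
Proof.
move=> pc pT; rewrite (par_below (@below_triple k)) //.
by rewrite big1 ?addbF // => q _; rewrite (negbTE pT) !andbF.
Qed.

(** The correction vanishes while [p] survives but may be 1 once [p] has left; this is what
    exchanges a' and a''. *)
Lemma par_triple k p q r :
  p \in T -> q \in T -> p != q -> r != p -> r != q -> T = p |: [set q; r] ->
  par c' k (f @: p) = par c k p (+) (alive (par c ^~ q) k (+) alive (par c ^~ r) k).
Proof.
move=> pT qT pq rp rq E.
by rewrite (par_below (@below_triple k)) ?Tchord // (xor_alive k pT qT pq rp rq E).
Qed.

Variable m : nat.
Let F k := Ggen (letter_of m c (pblock c k)).
Let F' k := Ggen (letter_of m c' (pblock c' k)).

Let pblock_swap k : pblock c' (f k) = f @: pblock c k.
Proof.
by apply: chord_pblock; rewrite ?im ?pblock_chord // imset_f // mem_chord_pblock.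
Qed.

Lemma letter_fixed k : f k = k -> F' k = F k.
Proof.
move=> fk; rewrite /F' -{1}fk pblock_swap; congr Ggen.
have pc := pblock_chord c k.
apply/esym/eq_letter_of; rewrite ?im // => j; rewrite par_notin_triple //.
apply/negP => pT; have := memT pT (mem_chord_pblock c k).
by rewrite coverT inE fk eqxx.
Qed.

Lemma letter_swap k : f k != k -> (F k * F (f k) = F' k * F' (f k))%g.
Proof.
(* The chord at [k] moves to [f k] and conversely, which accounts for the reversed order on the
   right of [triple_swap]. *)
move=> fk; rewrite /F' pblock_swap -{3}[k]fK pblock_swap.
have inT i : f i != i -> pblock c i \in T.
  move=> fi; have : i \in cover T by rewrite coverT inE.
  by case/bigcupP => y yT iy; rewrite (chord_pblock (Tchord yT) iy).
have pT := inT _ fk; have qT : pblock c (f k) \in T by apply: inT; rewrite fK eq_sym.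
have pq : pblock c k != pblock c (f k).
  apply: contraNneq (fT pT (mem_chord_pblock c k)) => ->; exact: mem_chord_pblock.
have [r [rT rp rq E]] := triple_third pT qT pq.
apply: (triple_swap (P := par c ^~ (pblock c k)) (Q := par c ^~ (pblock c (f k)))
  (R := par c ^~ r) (P' := par c' ^~ (f @: pblock c k)) (Q' := par c' ^~ (f @: pblock c (f k)))).
- by move=> j; apply: triple_even.
- by move=> j; apply: par_triple.
- move=> j; apply: par_triple; rewrite ?(eq_sym (pblock c (f k))) //.
  by rewrite setUCA.
- exact/letter_ofW/pblock_chord.
- exact/letter_ofW/pblock_chord.
- by move=> z; apply/letter_ofE/im/pblock_chord.
- by move=> z; apply/letter_ofE/im/pblock_chord.
Qed.

End TripleMove.

(** * Values of a product of three disjoint transpositions *)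

Section ThreeSwaps.
Variables (N : nat) (r r' s s' t t' : 'I_N).
Hypothesis distinct : uniq [:: r; r'; s; s'; t; t'].
Let f : 'I_N -> 'I_N := (tperm r r' * tperm s s' * tperm t t')%g.

Lemma swap3_id k : k \notin [:: r; r'; s; s'; t; t'] -> f k = k.
Proof.
rewrite !inE !negb_or => /and5P[? ? ? ? /andP[? ?]].
by rewrite /f !permM !tpermD 1?eq_sym.
Qed.

Lemma swap3E : [/\ f r = r', f s = s' & f t = t'] /\
  [/\ f r' = r, f s' = s & f t' = t].
Proof.
move: (distinct); rewrite /= !inE !negb_or => /and5P[/and5P[? ? ? ? ?]].
move=> /and4P[? ? ? ?] /and3P[? ? ?] /andP[? ?] /andP[? _].
split; split; rewrite /f !permM.
- by rewrite tpermL (@tpermD _ s) ?(@tpermD _ t) // eq_sym.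
- by rewrite (@tpermD _ r) ?tpermL ?(@tpermD _ t) // eq_sym.
- by rewrite (@tpermD _ r) ?(@tpermD _ s) ?tpermL // eq_sym.
- by rewrite tpermR (@tpermD _ s) ?(@tpermD _ t) // eq_sym.
- by rewrite (@tpermD _ r) ?tpermR ?(@tpermD _ t) // eq_sym.
- by rewrite (@tpermD _ r) ?(@tpermD _ s) ?tpermR // eq_sym.
Qed.
End ThreeSwaps.

Lemma move3_w m n (c c' : diagram n) : move3 c c' ->
  w m (Tagged diagram c) = w m (Tagged diagram c').
Proof.
case=> T [r [r' [s [s' [t [t' []]]]]]]; set f := (_ * _ * _)%g.
case=> Tc T3 coverT [rr ss tt] [nr ns nt] c'E.
have Ttriv : trivIset T := trivIsetS Tc (chords_triv c).
(* Three disjoint chords with two ends each cover six ends, so the six listed ends are distinct. *)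
have S6 : uniq [:: r; r'; s; s'; t; t'].
  have C6 : #|cover T| = 6.
    rewrite -(eqP Ttriv) (eq_bigr (fun=> 2)) ?sum_nat_const ?T3 // => p pT.
    exact/(card_chord (c := c))/(subsetP Tc).
  apply/card_uniqP; rewrite [RHS]/= -C6 coverT.
  by apply: eq_card => k; rewrite !inE !orbA.
have [[fr fs ft] [fr' fs' ft']] := swap3E S6.
have fid k : k \notin [:: r; r'; s; s'; t; t'] -> f k = k by apply: swap3_id.
have memS k : (k \in cover T) = (k \in [:: r; r'; s; s'; t; t']).
  by rewrite coverT !inE !orbA.
have fP k : k \in [:: r; r'; s; s'; t; t'] ->
    [/\ f (f k) = k, f k <= k.+1, f k != k & pblock T (f k) != pblock T k].
  rewrite !inE; do 5?[case/orP]; move=> /eqP ->;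
    rewrite ?fr ?fs ?ft ?fr' ?fs' ?ft' ?fr ?fs ?ft ?fr' ?fs' ?ft'; split;
    rewrite ?rr ?ss ?tt -?val_eqE /= ?rr ?ss ?tt //; try lia; by rewrite // eq_sym.
have fK : involutive f.
  by move=> k; case: (boolP (k \in [:: r; r'; s; s'; t; t'])) => [/fP[]|/fid E]; rewrite ?E.
have f_le k : f k <= k.+1.
  by case: (boolP (k \in [:: r; r'; s; s'; t; t'])) => [/fP[]|/fid ->].
have coverE : cover T = [set k | f k != k].
  apply/setP => k; rewrite memS [RHS]inE; apply/idP/idP => [/fP[]//|].
  by apply: contraR => /fid ->.
have fT (p : {set 'I_n.*2}) k : p \in T -> k \in p -> f k \notin p.
  move=> pT kp; have : k \in cover T by apply/bigcupP; exists p.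
  rewrite memS => /fP[_ _ _]; apply: contra => fkp.
  by rewrite !(def_pblock Ttriv pT).
(* Since [f] fixes the ends of the chords outside [T], the move amounts to applying [f] to all
   chords. *)
have c'E' : chords c' = [set f @: (b : {set _}) | b in chords c].
  have fixp p : p \in chords c :\: T -> f @: p = p.
    rewrite inE => /andP[pT pc]; rewrite -[RHS]imset_id; apply: eq_in_imset => k kp.
    apply: fid; apply: contra pT; rewrite -memS => /bigcupP[q qT kq].
    by rewrite -(chord_pblock pc kp) (chord_pblock (subsetP Tc _ qT) kq).
  rewrite c'E -[in RHS](setID (chords c) T) imsetU (setIidPr Tc) setUC; congr (_ :|: _).
  by rewrite (eq_in_imset (g := id)) ?imset_id.
rewrite !wE.
set F := fun k => Ggen (letter_of m c (pblock c k)); set F' := fun k => Ggen (letter_of m c' (pblock c' k)).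
have step := letter_swap fK f_le Tc T3 coverE fT c'E' m.
have fixed := letter_fixed fK f_le Tc T3 coverE fT c'E' m.
(* The letters are replaced one neighbouring pair at a time, each replacement preserving the
   product. *)
pose F1 k := if k \in [:: r; r'] then F' k else F k.
pose F2 k := if k \in [:: r; r'; s; s'] then F' k else F k.
have step1 : (\prod_k F k = \prod_k F1 k)%g.
  apply: (prod_pair rr) => [k kr kr'|]; first by rewrite /F1 !inE (negbTE kr) (negbTE kr').
  have := step r; rewrite fr eq_sym => ->; last by apply: contraNneq nr => ->.
  by rewrite /F1 !inE !eqxx orbT.
have step2 : (\prod_k F1 k = \prod_k F2 k)%g.
  apply: (prod_pair ss) => [k ks ks'|].
    by rewrite /F1 /F2 !inE (negbTE ks) (negbTE ks') !orbF.
  have [sr sr'] : s \notin [:: r; r'] /\ s' \notin [:: r; r'].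
    by split; apply: contraL S6; rewrite !inE => /orP[] /eqP ->;
      rewrite /= !inE !eqxx ?orbT ?andbF.
  rewrite /F1 (negbTE sr) (negbTE sr').
  have := step s; rewrite fs eq_sym => ->; last by apply: contraNneq ns => ->.
  by rewrite /F2 !inE !eqxx !orbT.
have step3 : (\prod_k F2 k = \prod_k F' k)%g.
  apply: (prod_pair tt) => [k kt kt'|].
    rewrite /F2; case: ifP => // /negbT ks; apply/esym/fixed/fid.
    by move: ks; rewrite !inE (negbTE kt) (negbTE kt') !orbF.
  have [tr tr'] : t \notin [:: r; r'; s; s'] /\ t' \notin [:: r; r'; s; s'].
    by split; apply: contraL S6; rewrite !inE => /or4P[] /eqP ->;
      rewrite /= !inE !eqxx ?orbT ?andbF.
  rewrite /F2 (negbTE tr) (negbTE tr').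
  by have := step t; rewrite ft eq_sym => ->; last by apply: contraNneq nt => ->.
by rewrite step1 step2 step3.
Qed.

Theorem corollary1 (m : nat) (hm : (0 < m)%N) (c1 c2 : {n : nat & diagram n}) :
  same_free_knot c1 c2 -> exists x : G m, w m c2 = (w m c1 ^ x)%g.
Proof.
elim=> {c1 c2} [c1 c2|c|c1 c2 _ [x ->]|c1 c2 c3 _ [x ->] _ [y ->]].
(* The three Reidemeister moves preserve [w] itself; only the change of the initial point requires a
   conjugation. *)
- case=> n c c' mv; last exact: move_rot_w; exists 1%g; rewrite conjg1.
  + exact/esym/move1_w.
  + exact/esym/move2_w.
  + exact/esym/move3_w.
- by exists 1%g; rewrite conjg1.
- by exists x^-1%g; rewrite conjgK.
- by exists (x * y)%g; rewrite conjgM.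
Qed.
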